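(* Let $(\mathcal{B},\mathcal{L},\theta,\mathcal{I}_\alpha)$ be a generalized Boolean dynamical system, $S$ its associated inverse semigroup, $\mathcal{G}_{tight}=\mathcal{G}_{tight}(S)$ the tight groupoid of $S$, and $\Gamma=\Gamma(\mathcal{B},\mathcal{L},\theta,\mathcal{I}_\alpha)$. Then the map $$\Phi:\mathcal{G}_{tight}\to\Gamma,\qquad [t,\phi]\mapsto\big((G_{(\beta)\alpha'}\circ H_{[\gamma]\alpha'})(\xi^\alpha),\,|\beta|-|\gamma|,\,\xi^\alpha\big),$$ where $\xi^\alpha$ is the filter associated with $\phi$ (with associated word $\alpha$) and $t=(\beta,A,\gamma)\in S$ is such that $(\gamma,A,\gamma)\in\xi^\alpha$, so that $\alpha=\gamma\alpha'$ for some $\alpha'\in\mathcal{W}^{\leq\infty}$, is a well-defined isomorphism of groupoids.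
   Context: **Generalized Boolean dynamical systems.** A Boolean algebra $\mathcal{B}$ is a (not necessarily unital) relatively complemented distributive lattice with least element $\emptyset$ and operations $\cap,\cup,\setminus$; $A\subseteq B$ means $A\cap B=A$. An ideal of $\mathcal{B}$ is a non-empty subset closed under finite unions and under intersection with arbitrary elements of $\mathcal{B}$. An action on $\mathcal{B}$ is a map $\mathcal{B}\to\mathcal{B}$ preserving $\cap,\cup,\setminus$ and $\emptyset$. A generalized Boolean dynamical system $(\mathcal{B},\mathcal{L},\theta,\mathcal{I}_\alpha)$ consists of a Boolean algebra $\mathcal{B}$, a set $\mathcal{L}$, actions $\{\theta_\alpha\}_{\alpha\in\mathcal{L}}$ on $\mathcal{B}$ and ideals $\{\mathcal{I}_\alpha\}_{\alpha\in\mathcal{L}}$ of $\mathcal{B}$ such that $\{A\in\mathcal{B}:A\subseteq\theta_\alpha(B)\text{ for some }B\in\mathcal{B}\}\subseteq\mathcal{I}_\alpha$ for all $\alpha\in\mathcal{L}$. **Words.** $\mathcal{L}^*$ is the set of finite words over $\mathcal{L}$ (including the empty word $\emptyset$), $\mathcal{L}^{\geq1}$ the non-empty finite words, $\mathcal{L}^\infty$ the infinite words, $|\alpha|$ the length, $\alpha_{i,j}=\alpha_i\cdots\alpha_j$ (empty if $j<i$). For $\alpha=\alpha_1\cdots\alpha_n$, $\theta_\alpha=\theta_{\alpha_n}\circ\cdots\circ\theta_{\alpha_1}$, $\theta_\emptyset=\mathrm{Id}$; $\mathcal{I}_\alpha=\{A\in\mathcal{B}:A\subseteq\theta_{\alpha_2\cdots\alpha_n}(B)\text{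 for some }B\in\mathcal{I}_{\alpha_1}\}$ for $n\ge1$, $\mathcal{I}_\emptyset=\mathcal{B}$. $\mathcal{W}^*=\{\alpha\in\mathcal{L}^*:\mathcal{I}_\alpha\neq\{\emptyset\}\}$, $\mathcal{W}^\infty=\{\alpha\in\mathcal{L}^\infty:\alpha_{1,n}\in\mathcal{W}^*\ \forall n\geq1\}$, $\mathcal{W}^{\leq\infty}=\mathcal{W}^*\cup\mathcal{W}^\infty$. **Inverse semigroup.** $S=\{(\alpha,A,\beta):\alpha,\beta\in\mathcal{L}^*,\ \emptyset\neq A\in\mathcal{I}_\alpha\cap\mathcal{I}_\beta\}\cup\{0\}$, with $0$ absorbing and $(\alpha,A,\beta)(\gamma,B,\delta)$ equal to $(\alpha,A\cap B,\delta)$ if $\beta=\gamma$; $(\alpha\gamma',\theta_{\gamma'}(A)\cap B,\delta)$ if $\gamma=\beta\gamma'$; $(\alpha,A\cap\theta_{\beta'}(B),\delta\beta')$ if $\beta=\gamma\beta'$ (interpreted as $0$ when the middle entry is $\emptyset$); and $0$ otherwise. $(\alpha,A,\beta)^*=(\beta,A,\alpha)$. $E=E(S)=\{(\alpha,A,\alpha):\emptyset\neq A\in\mathcal{I}_\alpha\}\cup\{0\}$ is its semilattice of idempotents ($e\le f$ iff $ef=e$). **Filters and tight filters.** A filter in a poset with least element is a non-empty, upward closed, downward directed subset not containing the least element. For a filter $\xi$ in $E$ there is a unique word $\alpha\in\mathcal{W}^{\leq\infty}$, the associated word, determined by: $\alpha$ is the longest first entry occurring in elements of $\xi$ if lengths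 are bounded, otherwise the infinite word all of whose finite beginnings of arbitrarily large length occur; every $(\beta,A,\beta)\in\xi$ has $\beta$ a beginning of $\alpha$. One writes $\xi=\xi^\alpha$ and $\xi_n=\{A\in\mathcal{I}_{\alpha_{1,n}}:(\alpha_{1,n},A,\alpha_{1,n})\in\xi\}$ for $0\le n\le|\alpha|$ ($n<\infty$). The filter is determined by $\alpha$ and the family $\{\xi_n\}_n$. A finite $Z\subseteq\{y\in E: y\leq x\}$ is a cover for $x\in E$ if every $0\neq y\le x$ satisfies $yz\ne0$ for some $z\in Z$. A filter $\xi$ is tight if for each $x\in\xi$ and each finite cover $Z$ of $x$, $Z\cap\xi\neq\emptyset$. $\mathsf{T}$ is the set of tight filters, $\mathsf{T}_\alpha$ those with associated word $\alpha$. A tight filter $\xi$ corresponds to the tight character $\phi:E\to\{0,1\}$, $\phi(e)=1\iff e\in\xi$; $\hat E_{tight}$ is the set of tight characters. **Cutting and gluing.** For $\alpha\in\mathcal{L}^{\geq1}$ and $\beta\in\mathcal{L}^*\cup\mathcal{L}^\infty$ with $\alpha\beta\in\mathcal{W}^{\leq\infty}$, let $\mathsf{T}_{(\alpha)\beta}=\{\xi\in\mathsf{T}_\beta:\xi_0\cap\mathcal{I}_\alpha\neq\emptyset\}$. The cutting map $H_{[\alpha]\beta}:\mathsf{T}_{\alpha\beta}\to\mathsf{T}_{(\alpha)\beta}$ sends $\xi$ to the (tight) filter $\eta$ with word $\beta$ and $\eta_n=\{B\in\mathcal{I}_{\beta_{1,n}}:A\subseteq B\text{ for some }A\in\xi_{|\alpha|+n}\}$,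 $0\le n\le|\beta|$. The gluing map $G_{(\alpha)\beta}:\mathsf{T}_{(\alpha)\beta}\to\mathsf{T}_{\alpha\beta}$ sends $\xi$ to the (tight) filter $\eta$ with word $\alpha\beta$ and $\eta_{|\alpha|+k}=\xi_k\cap\mathcal{I}_{\alpha\beta_{1,k}}$ for $0\le k\le|\beta|$, $\eta_i=\{A\in\mathcal{I}_{\alpha_{1,i}}:\theta_{\alpha_{i+1,|\alpha|}}(A)\in\eta_{|\alpha|}\}$ for $0\le i<|\alpha|$. For $\alpha=\emptyset$, $\mathsf{T}_{(\emptyset)\beta}=\mathsf{T}_\beta$ and $G_{(\emptyset)\beta}$, $H_{[\emptyset]\beta}$ are identity maps. **The groupoid $\Gamma$.** $\Gamma=\{(\eta^{\alpha\gamma},|\alpha|-|\beta|,\xi^{\beta\gamma})\in\mathsf{T}\times\mathbb{Z}\times\mathsf{T}:H_{[\alpha]\gamma}(\eta^{\alpha\gamma})=H_{[\beta]\gamma}(\xi^{\beta\gamma})\}$ ($\alpha,\beta$ ranging over finite words), with $(\eta,m,\xi)(\xi,n,\rho)=(\eta,m+n,\rho)$ and $(\eta,m,\xi)^{-1}=(\xi,-m,\eta)$. **The tight groupoid.** For $e\in E$ let $D_e=\{\phi\in\hat E_{tight}:\phi(e)=1\}$; for $s\in S$ let $\rho_s:D_{s^*s}\to D_{ss^*}$, $\rho_s(\phi)(e)=\phi(s^*es)$. On $\Omega=\{(s,\phi):\phi\in D_{s^*s}\}$ put $(s,\phi)\sim(t,\psi)$ iff $\phi=\psi$ and $se=te$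 for some $e\in E$ with $\phi\in D_e$. $\mathcal{G}_{tight}=\Omega/\!\sim$ with classes $[s,\phi]$, product $[s,\rho_t(\psi)][t,\psi]=[st,\psi]$ and inverse $[s,\phi]^{-1}=[s^*,\rho_s(\phi)]$. *)

(* Defs.v *)
From mathcomp Require Import all_boot all_order all_algebra.
From mathcomp Require Import boolp classical_sets functions cardinality.

Set Implicit Arguments.
Unset Strict Implicit.
Unset Printing Implicit Defensive.

Import Order.TTheory.
Local Open Scope classical_set_scope.
Local Open Scope order_scope.

(* Groupoids. The partial product and the inverse are given by their graphs:  *)
(* [gmul x y z] means that (x, y) is composable with product z, and           *)
(* [ginv x y] means that y is the inverse of x.                               *)

Record groupoid_data := GroupoidData {
  arrow :> Type;
  gmul : arrow -> arrow -> arrow -> Prop;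
  ginv : arrow -> arrow -> Prop
}.

Definition composable (G : groupoid_data) (x y : G) := exists z, gmul x y z.

Record is_groupoid (G : groupoid_data) : Prop := IsGroupoid {
  gmul_fun : forall x y z z' : G, gmul x y z -> gmul x y z' -> z = z';
  ginv_fun : forall x y y' : G, ginv x y -> ginv x y' -> y = y';
  ginv_total : forall x : G, exists y, ginv x y;
  ginv_invol : forall x y : G, ginv x y -> ginv y x;
  gmul_assoc : forall x y z : G, composable x y -> composable y z ->
    exists xy yz w, [/\ gmul x y xy, gmul y z yz, gmul xy z w & gmul x yz w];
  gmul_invl : forall x x' : G, ginv x x' -> composable x' x /\
    forall y xy, gmul x y xy -> gmul x' xy y;
  gmul_invr : forall x x' : G, ginv x x' -> composable x x' /\
    forall z zx, gmul z x zx -> gmul zx x' z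
}.

Definition groupoid_hom (G H : groupoid_data) (f : G -> H) :=
  forall x y z : G, gmul x y z -> gmul (f x) (f y) (f z).

Definition groupoid_iso (G H : groupoid_data) (f : G -> H) :=
  [/\ is_groupoid G, is_groupoid H, groupoid_hom f &
      exists g : H -> G, [/\ cancel f g, cancel g f & groupoid_hom g]].

(* A [cbDistrLatticeType] is a relatively complemented distributive lattice   *)
(* with a least element, possibly without a greatest one.                     *)

Definition is_ideal d (B : cbDistrLatticeType d) (I : set B) :=
  [/\ I !=set0, (forall x y, I x -> I y -> I (x `|` y)) &
      forall x y, I x -> I (x `&` y)].

Definition is_action d (B : cbDistrLatticeType d) (f : B -> B) :=
  [/\ {morph f : x y / x `&` y}, {morph f : x y / x `|` y},
      {morph f : x y / x `\` y} & f \bot = \bot].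

Record gbds d (B : cbDistrLatticeType d) (L : eqType) := Gbds {
  theta : L -> B -> B;
  ideal : L -> set B;
  theta_action : forall a, is_action (theta a);
  ideal_ideal : forall a, is_ideal (ideal a);
  ideal_range : forall a x y, x <= theta a y -> ideal a x
}.

Inductive xword (L : Type) := Fin of seq L | Inf of (nat -> L).

Definition xcat (L : Type) (s : seq L) (w : xword L) : xword L :=
  match w with
  | Fin t => Fin (s ++ t)
  | Inf f => Inf (fun n => nth (f (n - size s)%N) s n)
  end.

(* The beginning w_{1,n}; it is only used for n <= |w|. *)
Definition xtake (L : Type) (n : nat) (w : xword L) : seq L :=
  match w with Fin t => take n t | Inf f => mkseq f n end.

Definition le_xsize (L : Type) (n : nat) (w : xword L) : bool :=
  match w with Fin t => (n <= size t)%N | Inf _ => true end.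

Definition beginning (L : Type) (s : seq L) (w : xword L) :=
  exists2 n, le_xsize n w & s = xtake n w.

Section BooleanDynamicalSystem.
Context (d : Order.disp_t) (B : cbDistrLatticeType d) (L : eqType).
Variable X : gbds B L.

Definition thetaw (s : seq L) (x : B) : B := foldl (fun y a => theta X a y) x s.

Definition idealw (s : seq L) : set B :=
  if s is a :: s' then [set x | exists2 y, ideal X a y & x <= thetaw s' y]
  else setT.

Definition in_W (w : xword L) : Prop :=
  match w with
  | Fin s => idealw s <> [set \bot]
  | Inf f => forall n, (1 <= n)%N -> idealw (mkseq f n) <> [set \bot]
  end.

(* [None] encodes the zero of S. *)

Definition in_S (s : option (seq L * B * seq L)) : Prop :=
  if s is Some (a, x, b) then [/\ x <> \bot, idealw a x & idealw b x] else True.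

Definition S := {s : option (seq L * B * seq L) | `[< in_S s >]}.

Definition zeroS : S := Sub None (introT (asboolP _) I).

Definition triple (a : seq L) (x : B) (b : seq L) : option (seq L * B * seq L) :=
  if x == \bot then None else Some (a, x, b).

Definition mul_raw (s t : option (seq L * B * seq L)) :=
  match s, t with
  | Some (a, x, b), Some (c, y, e) =>
    if b == c then triple a (x `&` y) e
    else if prefix b c then
      let c' := drop (size b) c in triple (a ++ c') (thetaw c' x `&` y) e
    else if prefix c b then
      let b' := drop (size c) b in triple a (x `&` thetaw b' y) (e ++ b')
    else None
  | _, _ => None
  end.

Definition star_raw (s : option (seq L * B * seq L)) :=
  if s is Some (a, x, b) then Some (b, x, a) else None.

Lemma thetaw_cat s t x : thetaw (s ++ t) x = thetaw t (thetaw s x).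
Proof. by rewrite /thetaw foldl_cat. Qed.

Lemma thetaI a x y : theta X a (x `&` y) = theta X a x `&` theta X a y.
Proof. by case: (theta_action X a) => h _ _ _; exact: h. Qed.

Lemma thetawI s x y : thetaw s (x `&` y) = thetaw s x `&` thetaw s y.
Proof. by elim: s x y => //= a s IH x y; rewrite thetaI IH. Qed.

Lemma idealw_le s x y : x <= y -> idealw s y -> idealw s x.
Proof.
case: s => //= a s xy [z az yz]; exists z => //; exact: le_trans xy yz.
Qed.

Lemma thetaw_le s x y : x <= y -> thetaw s x <= thetaw s y.
Proof. by move=> /meet_idPl xy; apply/meet_idPl; rewrite -thetawI xy. Qed.

Lemma idealw_thetaw s t x : idealw s x -> idealw (s ++ t) (thetaw t x).
Proof.
case: s => [_|a s] /=.
  by case: t => //= a t; exists (theta X a x) => //; exact: (ideal_range (lexx (theta X a x))).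
by case=> y ay xy; exists y => //; rewrite thetaw_cat thetaw_le.
Qed.

Lemma triple_in_S a x b : idealw a x -> idealw b x -> in_S (triple a x b).
Proof. by rewrite /triple; case: eqP. Qed.

Lemma mul_in_S s t : in_S s -> in_S t -> in_S (mul_raw s t).
Proof.
case: s => [[[a x] b]|//]; case: t => [[[c y] e]|//] [_ ax bx] [_ cy ey] /=.
case: eqP => [_|_].
  apply: triple_in_S; first by apply: idealw_le ax; rewrite leIl.
  by apply: idealw_le ey; rewrite leIr.
case: ifP => [_|_].
  apply: triple_in_S; last by apply: idealw_le ey; rewrite leIr.
  by apply: idealw_le (idealw_thetaw _ ax); rewrite leIl.
case: ifP => // _; apply: triple_in_S; first by apply: idealw_le ax; rewrite leIl.
by apply: idealw_le (idealw_thetaw _ ey); rewrite leIr.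
Qed.

Lemma star_in_S s : in_S s -> in_S (star_raw s).
Proof. by case: s => [[[a x] b]|//] []. Qed.

Lemma S_in_S (s : S) : in_S (val s).
Proof. exact: asboolW (valP s). Qed.

Definition mulS (s t : S) : S :=
  Sub (mul_raw (val s) (val t))
    (introT (asboolP _) (mul_in_S (S_in_S s) (S_in_S t))).

Definition starS (s : S) : S :=
  Sub (star_raw (val s)) (introT (asboolP _) (star_in_S (S_in_S s))).

Definition idem_raw (s : option (seq L * B * seq L)) : bool :=
  if s is Some (a, _, b) then a == b else true.

Definition E := {s : S | idem_raw (val s)}.

Definition zeroE : E := Sub zeroS isT.

Definition leE (e f : E) : Prop := mulS (val e) (val f) = val e.

Lemma idem_triple a x : idem_raw (triple a x a).
Proof. by rewrite /triple; case: ifP => //= _; rewrite eqxx. Qed.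

Lemma idem_starM (s : S) : idem_raw (val (mulS (starS s) s)).
Proof.
by rewrite /=; case: (val s) => [[[a x] b]|] //=; rewrite eqxx idem_triple.
Qed.

Lemma idem_conj_raw s e :
  idem_raw e -> idem_raw (mul_raw (mul_raw (star_raw s) e) s).
Proof.
case: s => [[[a x] b]|//]; case: e => [[[c y] c']|//] /= /eqP <- {c'}.
case: eqP => [ac|/eqP ac].
  rewrite {1}/triple; case: ifP => //= _.
  by rewrite ac eqxx idem_triple.
case: ifP => [pac|npac].
  rewrite {1}/triple; case: ifP => //= _; rewrite eq_sym (negPf ac) pac.
  have -> : prefix c a = false.
    apply/negP => pca; case/eqP: ac; case/prefixP: pac pca => v ->.
    case/prefixP => u au; move: (congr1 size au); rewrite !size_cat => /eqP.
    rewrite -{1}[size a]addn0 -addnA eqn_add2l eq_sym addn_eq0 size_eq0.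
    by case/andP => /eqP -> _; rewrite cats0.
  exact: idem_triple.
case: ifP => // /prefixP[u au]; rewrite {1}/triple; case: ifP => //= _.
by rewrite au drop_size_cat // eqxx idem_triple.
Qed.

Definition dom_idem (s : S) : E := Sub (mulS (starS s) s) (idem_starM s).

Definition conjE (s : S) (e : E) : E :=
  Sub (mulS (mulS (starS s) (val e)) s) (idem_conj_raw (val s) (valP e)).

Definition is_filter (xi : set E) : Prop :=
  [/\ xi !=set0,
      (forall e f, xi e -> leE e f -> xi f),
      (forall e f, xi e -> xi f -> exists g, [/\ xi g, leE g e & leE g f]) &
      ~ xi zeroE].

Definition is_cover (x : E) (Z : set E) : Prop :=
  [/\ finite_set Z, (forall z, Z z -> leE z x) &
      forall y, y <> zeroE -> leE y x ->
        exists2 z, Z z & mulS (val y) (val z) <> zeroS].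

Definition is_tight (xi : set E) : Prop :=
  is_filter xi /\
  forall x Z, xi x -> is_cover x Z -> exists2 z, Z z & xi z.

(* [idem_in xi a x] means that (a, x, a) is an element of xi. *)
Definition idem_in (xi : set E) (a : seq L) (x : B) : Prop :=
  exists2 e : E, xi e & val (val e) = Some (a, x, a).

(* Since all first entries are beginnings of w, the finite word w occurring as *)
(* a first entry is the longest one.                                          *)
Definition assoc_word (xi : set E) (w : xword L) : Prop :=
  [/\ in_W w, (forall a x, idem_in xi a x -> beginning a w) &
      match w with
      | Fin s => exists x, idem_in xi s x
      | Inf f => forall n, exists m x, (n <= m)%N /\ idem_in xi (mkseq f m) x
      end].

Definition T_ (w : xword L) : set (set E) :=
  [set xi | is_tight xi /\ assoc_word xi w].

(* The set xi_n, for a filter xi with associated word w. *)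
Definition level (xi : set E) (w : xword L) (n : nat) : set B :=
  [set x | idealw (xtake n w) x /\ idem_in xi (xtake n w) x].

Definition filter_of (w : xword L) (F : nat -> set B) : set E :=
  [set e | exists n x, [/\ le_xsize n w, F n x &
                           val (val e) = Some (xtake n w, x, xtake n w)]].

(* [Tcut a w] is T_{(a)w}, and [cut a w], [glue a w] are the formulas of       *)
(* H_{[a]w} and G_{(a)w}, extended to arbitrary subsets of E.                 *)

Definition Tcut (a : seq L) (w : xword L) : set (set E) :=
  [set xi | T_ w xi /\
     (a <> [::] ->
        in_W (xcat a w) /\ exists x, level xi w 0 x /\ idealw a x)].

Definition cut (a : seq L) (w : xword L) (xi : set E) : set E :=
  if a is [::] then xi else
  filter_of w (fun n => [set y | idealw (xtake n w) y /\
    exists x, level xi (xcat a w) (size a + n) x /\ x <= y]).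

Definition glue_level (a : seq L) (w : xword L) (xi : set E) (k : nat) : set B :=
  [set x | level xi w k x /\ idealw (a ++ xtake k w) x].

Definition glue (a : seq L) (w : xword L) (xi : set E) : set E :=
  if a is [::] then xi else
  filter_of (xcat a w) (fun n =>
    if (n < size a)%N then
      [set x | idealw (take n a) x /\ glue_level a w xi 0 (thetaw (drop n a) x)]
    else glue_level a w xi (n - size a)).

Definition sizediff (a b : seq L) : int := ((size a)%:Z - (size b)%:Z)%R.

Definition in_Gamma (g : set E * int * set E) : Prop :=
  exists (a b : seq L) (w : xword L),
    [/\ T_ (xcat a w) g.1.1, T_ (xcat b w) g.2, g.1.2 = sizediff a b &
        cut a w g.1.1 = cut b w g.2].

Definition Gamma_arrow := {g : set E * int * set E | `[< in_Gamma g >]}.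

Definition Gamma_mul (g h k : Gamma_arrow) : Prop :=
  (val g).2 = (val h).1.1 /\
  val k = ((val g).1.1, ((val g).1.2 + (val h).1.2)%R, (val h).2).

Definition Gamma_inv (g h : Gamma_arrow) : Prop :=
  val h = ((val g).2, (- (val g).1.2)%R, (val g).1.1).

Definition Gamma : groupoid_data := GroupoidData Gamma_mul Gamma_inv.

Definition filter_of_char (phi : E -> bool) : set E := [set e | phi e].

Definition tight_char (phi : E -> bool) : Prop := is_tight (filter_of_char phi).

Definition rho (s : S) (phi : E -> bool) : E -> bool := fun e => phi (conjE s e).

Definition Omega :=
  {w : S * (E -> bool) | `[< tight_char w.2 /\ w.2 (dom_idem w.1) >]}.

Definition germ_eq (w w' : Omega) : Prop :=
  (val w).2 = (val w').2 /\
  exists e : E, (val w).2 e /\ mulS (val w).1 (val e) = mulS (val w').1 (val e).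

Definition Gtight_arrow :=
  {C : set Omega | `[< exists w, C = [set w' | germ_eq w w'] >]}.

Definition germ (w : Omega) : Gtight_arrow :=
  Sub [set w' | germ_eq w w'] (introT (asboolP _) (ex_intro _ w erefl)).

Definition Gtight_mul (x y z : Gtight_arrow) : Prop :=
  exists u v w : Omega,
    [/\ x = germ u, y = germ v, z = germ w,
        (val u).2 = rho (val v).1 (val v).2 &
        val w = (mulS (val u).1 (val v).1, (val v).2)].

Definition Gtight_inv (x y : Gtight_arrow) : Prop :=
  exists u v : Omega,
    [/\ x = germ u, y = germ v &
        val v = (starS (val u).1, rho (val u).1 (val u).2)].

Definition Gtight : groupoid_data := GroupoidData Gtight_mul Gtight_inv.

(* [is_Phi F] states that the formula defining Phi makes sense for every      *)
(* representative (t, phi), t = (b, x, c), and that F is given by it. The     *)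
(* condition (c, x, c) \in xi is the condition (t, phi) \in Omega, since      *)
(* t^* t = (c, x, c).                                                         *)

Definition is_Phi (F : Gtight -> Gamma) : Prop :=
  forall (u : Omega) (b c : seq L) (x : B),
    val (val u).1 = Some (b, x, c) ->
    let xi := filter_of_char (val u).2 in
    (exists w : xword L,
       [/\ in_W w, assoc_word xi (xcat c w) & Tcut b w (cut c w xi)]) /\
    (forall w : xword L, assoc_word xi (xcat c w) ->
       val (F (germ u)) = (glue b w (cut c w xi), sizediff b c, xi)).

End BooleanDynamicalSystem.

(* Main.v *)
From mathcomp Require Import all_boot all_order all_algebra ring zify.
From mathcomp Require Import boolp classical_sets cardinality.
Require Import Defs.

(* Everything is expressed through one operation on filters: for s in S let   *)
(* [rset s xi] = {e in E | s^* e s in xi}, which is rho_s on characters. For  *)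
(* t = (b, A, c) with (c, A, c) in xi, cutting is [rset (0, A, c)] and gluing *)
(* is [rset (b, A, 0)], where 0 is the empty word; as (b, A, c) =             *)
(* (b, A, 0)(0, A, c), the map Phi sends [t, phi] to the triple               *)
(* (rho_t phi, |b| - |c|, phi). These triples separate germs, because the     *)
(* words occurring in a filter are comparable, and they exhaust Gamma; the    *)
(* groupoid structure of the germs is then transported from Gamma.            *)

Set Implicit Arguments.
Unset Strict Implicit.
Unset Printing Implicit Defensive.

Import Order.TTheory GRing.Theory.
Local Open Scope classical_set_scope.
Local Open Scope order_scope.

(** The inverse semigroup acts partially on its tight filters: s sends a filter xi containing s^* s
    to s.xi = {e : s^* e s in xi}. This respects products ([rset_mulS]), is trivial for the
    idempotents in xi ([rset_idem]) and preserves tightness ([rset_tight]), since conjugation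
    identifies the idempotents below s s^* with those below s^* s. By [cutE] and [glueE], cutting c
    and gluing b are the actions of (0, A, c) and (b, A, 0), whichever admissible A is taken; so Phi
    sends the germ of s = (b, A, c) at xi to (s.xi, |b| - |c|, xi).

    Phi is well defined because multiplying s by an idempotent in xi changes neither s.xi nor the
    degree |b| - |c|. For injectivity ([germ_separation]), let (b, A, c) and (b', A', c') have the
    same triple. The words c and c' occur in xi, hence are comparable, say c' = cv; equal degrees
    and equal images force b' = bv, and the two elements agree after multiplication by the
    idempotent of xi with word cv and middle entry the meet of theta_v(A) and A'. For surjectivity
    ([germ_triple_surj]), let p and q realize the two cuts in H_a(eta) = H_b(xi); then p.eta = q.xi,
    so p^* q sends xi to eta and has degree |a| - |b|. If a and b are both empty, then eta = xi and
    any idempotent in xi serves.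

    Products and inverses of germs correspond exactly to those of triples, so the groupoid axioms
    need only be checked in Gamma; composites exist there because arrows lift to germs. *)

Local Notation "s ** t" := (mulS s t) (at level 40, left associativity).

(** * Prefixes, and beginnings of finite or infinite words *)

Section Words.
Context (L : eqType).
Implicit Types (s t : seq L) (w : xword L).

Variant compare_words s t : Prop :=
  | CompareLe v of t = s ++ v
  | CompareGe v of s = t ++ v
  | CompareNone of ~~ prefix s t & ~~ prefix t s.

Lemma compare_wordsP s t : compare_words s t.
Proof.
have [/prefixP[v ->]|nst] := boolP (prefix s t); first exact: CompareLe.
have [/prefixP[v ->]|nts] := boolP (prefix t s); first exact: CompareGe.
exact: CompareNone.
Qed.

Lemma prefix_cat2l s t v : prefix (s ++ t) (s ++ v) = prefix t v.
Proof. by rewrite prefix_catr // eqxx. Qed.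

Lemma prefix_comparable s t u :
  prefix s u -> prefix t u -> prefix s t || prefix t s.
Proof.
case/prefixP=> v ->; have [p ->|p ->|nst nts] := compare_wordsP s t.
- by rewrite prefix_prefix.
- by rewrite prefix_prefix orbT.
move=> tsv; elim: s t nst nts tsv => [|a s IH] [|b t] //=.
by rewrite [b == a]eq_sym; case: (a == b) => //=; exact: IH.
Qed.

Lemma prefix_catN s t v : ~~ prefix s t -> ~~ prefix t s ->
  ~~ prefix (s ++ v) t /\ ~~ prefix t (s ++ v).
Proof.
move=> nst nts; split; apply/negP => p.
  by case/negP: nst; exact: prefix_trans (prefix_prefix _ _) p.
have := prefix_comparable (prefix_prefix s v) p.
by rewrite (negPf nst) (negPf nts).
Qed.

Lemma xtake_cat s w n : xtake (size s + n) (xcat s w) = s ++ xtake n w.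
Proof.
case: w => [t|f] /=; first by rewrite take_cat ltnNge leq_addr addKn.
rewrite /mkseq iotaD map_cat; congr (_ ++ _).
  case: s => [//|a s]; apply: (@eq_from_nth _ a); rewrite size_map size_iota //.
  move=> i ls; rewrite (nth_map 0) ?size_iota // nth_iota // add0n.
  exact: set_nth_default.
rewrite add0n -[X in iota X]addn0 iotaDl -map_comp.
apply: eq_map => i /=.
by rewrite nth_default ?leq_addr // addKn.
Qed.

Lemma xtake_catl s w n : (n <= size s)%N -> xtake n (xcat s w) = take n s.
Proof.
move=> ns; case: w => [t|f] /=.
  by rewrite takel_cat.
case: s ns => [|a s] ns; first by case: n ns.
apply: (@eq_from_nth _ a); rewrite size_map size_iota ?size_takel //.
move=> i ls; rewrite (nth_map 0) ?size_iota // nth_iota // add0n nth_take //.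
by apply: set_nth_default; exact: leq_trans ls ns.
Qed.

Lemma le_xsize_cat s w n : le_xsize (size s + n) (xcat s w) = le_xsize n w.
Proof. by case: w => //= t; rewrite size_cat leq_add2l. Qed.

Lemma le_xsize_catl s w n : (n <= size s)%N -> le_xsize n (xcat s w).
Proof. by case: w => //= t ns; rewrite size_cat (leq_trans ns) ?leq_addr. Qed.

Lemma size_xtake w n : le_xsize n w -> size (xtake n w) = n.
Proof. by case: w => [t|f] /= => [/size_takel//|_]; rewrite size_mkseq. Qed.

Lemma beginning_cat s t w : beginning (s ++ t) (xcat s w) <-> beginning t w.
Proof.
split=> [[n nw e]|[n nw ->]]; last first.
  by exists (size s + n)%N; rewrite ?le_xsize_cat ?xtake_cat.
have en : n = (size s + size t)%N by rewrite -size_cat e size_xtake.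
move: nw e; rewrite {n}en le_xsize_cat xtake_cat => nw /eqP.
by rewrite eqseq_cat // eqxx => /eqP e; exists (size t).
Qed.

Lemma beginning_take s n w : (n <= size s)%N -> beginning (take n s) (xcat s w).
Proof. by exists n; rewrite ?le_xsize_catl ?xtake_catl. Qed.

Lemma beginning_split s w : beginning s w -> exists w', w = xcat s w'.
Proof.
case: w => [t|f] [n /= nw ->].
  by exists (Fin (drop n t)); rewrite /= cat_take_drop.
exists (Inf (fun k => f (n + k)%N)) => /=; congr Inf; apply/funext => k.
rewrite size_mkseq; have [kn|nk] := ltnP k n; first by rewrite nth_mkseq.
by rewrite nth_default ?size_mkseq // subnKC.
Qed.

Lemma xtake_nat_cat (f : nat -> L) m n :
  (n <= m)%N -> exists v, mkseq f m = mkseq f n ++ v.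
Proof.
by move/subnKC <-; exists [seq f i | i <- iota n (m - n)];
   rewrite /mkseq iotaD map_cat.
Qed.

End Words.

(** * Products of triples: associativity and involution *)

Section Semigroup.
Context (d : Order.disp_t) (B : cbDistrLatticeType d) (L : eqType).
Context (X : gbds B L).
Implicit Types (a b c v : seq L) (x y z : B).
Local Notation raw := (option (seq L * B * seq L)).

Lemma thetaw_bot v : thetaw X v \bot = \bot.
Proof. by elim: v => //= a v; case: (theta_action X a) => _ _ _ ->. Qed.

(** If v starts with the letter b, what remains after dropping [a] lies below theta of an element in
    the range of theta_b, and that range is contained in I_b. *)
Lemma idealw_suffix a v x : idealw X (a ++ v) x -> idealw X v x.
Proof.
case: a => // a s [y ya xy]; case: v xy => //= b v.
rewrite thetaw_cat /= => xy; exists (theta X b (thetaw X s y)) => //.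
exact: (ideal_range (lexx _)).
Qed.

Lemma triple_bot a b : triple a \bot b = None :> raw.
Proof. by rewrite /triple eqxx. Qed.

(** Allowing v to be empty merges equality of words with strict extension, so that products are
    computed in the three cases of [compare_wordsP]. *)
Lemma mul_raw_catl a x b v y c :
  mul_raw X (Some (a, x, b)) (Some (b ++ v, y, c)) =
  triple (a ++ v) (thetaw X v x `&` y) c.
Proof.
rewrite /=; case: eqP => [/eqP|_].
  rewrite -{1}[b]cats0 eqseq_cat // eqxx => /eqP <-.
  by rewrite cats0.
by rewrite prefix_prefix drop_size_cat.
Qed.

Lemma mul_raw_catr a x c v y e :
  mul_raw X (Some (a, x, c ++ v)) (Some (c, y, e)) =
  triple a (x `&` thetaw X v y) (e ++ v).
Proof.
rewrite /=; case: eqP => [/eqP|].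
  rewrite -{2}[c]cats0 eqseq_cat // eqxx => /eqP ->.
  by rewrite cats0.
case: ifP => [|_ _]; last by rewrite prefix_prefix drop_size_cat.
rewrite -{2}[c]cats0 prefix_cat2l; by case: v => //; rewrite cats0.
Qed.

Lemma mul_raw_none a x b c y e : ~~ prefix b c -> ~~ prefix c b ->
  mul_raw X (Some (a, x, b)) (Some (c, y, e)) = None.
Proof.
move=> bc cb /=; rewrite (negPf bc) (negPf cb); case: eqP bc => // ->.
by rewrite prefix_refl.
Qed.

Lemma mul_rawN (s : raw) : mul_raw X s None = None.
Proof. by case: s => [[[? ?] ?]|]. Qed.

(** Since theta preserves [\bot], a triple with middle entry [\bot] multiplies like zero;
    intermediate products need not be tested for vanishing. *)
Lemma mul_triplel a x b (t : raw) :
  mul_raw X (triple a x b) t = mul_raw X (Some (a, x, b)) t.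
Proof.
rewrite /triple; case: eqP => // ->; case: t => [[[c y] e]|//] /=.
by do ?case: ifP => _; rewrite ?thetaw_bot ?meet0x ?triple_bot.
Qed.

Lemma mul_tripler a x b (s : raw) :
  mul_raw X s (triple a x b) = mul_raw X s (Some (a, x, b)).
Proof.
rewrite /triple; case: eqP => // ->; case: s => [[[c y] e]|//] /=.
by do ?case: ifP => _; rewrite ?thetaw_bot ?meetx0 ?triple_bot.
Qed.

Lemma mul_rawA (s t u : raw) :
  mul_raw X s (mul_raw X t u) = mul_raw X (mul_raw X s t) u.
Proof.
case: s => [[[a x] b]|]; last by [].
case: t => [[[c y] e]|]; last by [].
case: u => [[[f z] g]|]; last by rewrite !mul_rawN.
have [v ->|v ->|bc cb] := compare_wordsP b c.
- rewrite mul_raw_catl mul_triplel.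
  have [w ->|w ->|ef fe] := compare_wordsP e f.
  + by rewrite !mul_raw_catl mul_tripler -!catA mul_raw_catl thetaw_cat thetawI meetA.
  + by rewrite !mul_raw_catr mul_tripler mul_raw_catl meetA.
  + by rewrite [mul_raw X (Some (b ++ v, y, e)) _]mul_raw_none // mul_raw_none ?mul_rawN.
- rewrite mul_raw_catr mul_triplel.
  have [w ->|w ->|ef fe] := compare_wordsP e f.
  + rewrite mul_raw_catl mul_tripler.
    (* Both outer words extend those of the middle triple, so the result depends on how the
       overhangs v and w compare. *)
    have [p ->|p ->|vw wv] := compare_wordsP v w.
    * by rewrite !catA !mul_raw_catl thetaw_cat !thetawI -meetA.
    * by rewrite !catA !mul_raw_catr thetaw_cat !thetawI -!meetA.
    * by rewrite !mul_raw_none ?prefix_cat2l.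
  + rewrite mul_raw_catr mul_tripler mul_raw_catr -!catA mul_raw_catr.
    by rewrite thetaw_cat thetawI meetA.
  + rewrite (mul_raw_none c y z g ef fe) mul_rawN.
    by have [ev ve] := prefix_catN v ef fe; rewrite mul_raw_none.
- rewrite (mul_raw_none a x y e bc cb).
  have [w ->|w ->|ef fe] := compare_wordsP e f.
  + have [cw wc] := prefix_catN w cb bc.
    by rewrite mul_raw_catl mul_tripler mul_raw_none.
  + by rewrite mul_raw_catr mul_tripler mul_raw_none.
  + by rewrite (mul_raw_none c y z g ef fe).
Qed.

Lemma star_triple a x b : star_raw (triple a x b) = triple b x a :> raw.
Proof. by rewrite /triple; case: ifP. Qed.

Lemma star_rawM (s t : raw) :
  star_raw (mul_raw X s t) = mul_raw X (star_raw t) (star_raw s).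
Proof.
case: s => [[[a x] b]|]; last by rewrite mul_rawN.
case: t => [[[c y] e]|//].
have [v ->|v ->|bc cb] := compare_wordsP b c.
- by rewrite mul_raw_catl star_triple mul_raw_catr meetC.
- by rewrite mul_raw_catr star_triple mul_raw_catl meetC.
- by rewrite !mul_raw_none.
Qed.

End Semigroup.

(** * The semilattice of idempotents and the action of S on filters *)

Section InverseSemigroup.
Context (d : Order.disp_t) (B : cbDistrLatticeType d) (L : eqType).
Context (X : gbds B L).
Implicit Types (s t u : S X) (e f g : E X) (xi : set (E X)).

Lemma mulSA s t u : s ** (t ** u) = s ** t ** u.
Proof. by apply: val_inj; exact: mul_rawA. Qed.

Lemma mul0S s : zeroS X ** s = zeroS X.
Proof. exact: val_inj. Qed.

Lemma mulS0 s : s ** zeroS X = zeroS X.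
Proof. by apply: val_inj; exact: mul_rawN. Qed.

Lemma starSK s : starS (starS s) = s.
Proof. by apply: val_inj => /=; case: (val s) => [[[]]|]. Qed.

Lemma starSM s t : starS (s ** t) = starS t ** starS s.
Proof. by apply: val_inj; exact: star_rawM. Qed.

Lemma mulSVS s : s ** starS s ** s = s.
Proof.
apply: val_inj; have := S_in_S s; rewrite /=.
case: (sval s) => [[[a x] b]|//] [/eqP x0 _ _] /=.
by rewrite eqxx meetxx mul_triplel /= eqxx meetxx /triple (negPf x0).
Qed.

Lemma idem_star s : idem_raw (val s) -> starS s = s.
Proof.
by move=> h; apply: val_inj; move: h; rewrite /=;
   case: (sval s) => [[[a x] b]|] //= /eqP->.
Qed.

Lemma idem_mulC s t :
  idem_raw (val s) -> idem_raw (val t) -> s ** t = t ** s.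
Proof.
move=> hs ht; apply: val_inj; move: hs ht => /=.
case: (sval s) => [[[a x] a']|]; last by rewrite mul_rawN.
case: (sval t) => [[[b y] b']|//]; rewrite {1 2}/idem_raw => /eqP<- /eqP<-.
have [v ->|v ->|ab ba] := compare_wordsP a b.
- by rewrite mul_raw_catl mul_raw_catr meetC.
- by rewrite mul_raw_catl mul_raw_catr meetC.
- by rewrite !mul_raw_none.
Qed.

Lemma idem_mulss s : idem_raw (val s) -> s ** s = s.
Proof.
move=> h; apply: val_inj; have := S_in_S s; move: h; rewrite /=.
case: (sval s) => [[[a x] _]|//] /= /eqP<- [/eqP x0 _ _].
by rewrite eqxx meetxx /triple (negPf x0).
Qed.

Lemma idem_mul_raw s t :
  idem_raw (val s) -> idem_raw (val t) -> idem_raw (val (s ** t)).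
Proof.
rewrite /=; case: (sval s) => [[[a x] a']|//]; case: (sval t) => [[[b y] b']|//].
rewrite {1 2}/idem_raw => /eqP<- /eqP<-; have [v ->|v ->|ab ba] := compare_wordsP a b.
- by rewrite mul_raw_catl idem_triple.
- by rewrite mul_raw_catr idem_triple.
- by rewrite mul_raw_none.
Qed.

Definition mulE e f : E X := Sub (val e ** val f) (idem_mul_raw (valP e) (valP f)).

Lemma mulEC e f : mulE e f = mulE f e.
Proof. by apply: val_inj; exact: idem_mulC (valP e) (valP f). Qed.

Lemma mulEA e f g : mulE e (mulE f g) = mulE (mulE e f) g.
Proof. by apply: val_inj; exact: mulSA. Qed.

Lemma mulEE e : mulE e e = e.
Proof. by apply: val_inj; exact: idem_mulss (valP e). Qed.

Lemma leEE e f : leE e f <-> mulE e f = e.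
Proof. by split=> [h|/(congr1 val)//]; apply: val_inj. Qed.

Lemma leE_mull e f : leE (mulE e f) e.
Proof. by apply/leEE; rewrite mulEC mulEA mulEE. Qed.

Lemma starE e : starS (val e) = val e.
Proof. by exact: idem_star (valP e). Qed.

Lemma range_commute s e :
  s ** starS s ** val e = val e ** (s ** starS s).
Proof.
apply: idem_mulC (valP e); rewrite -{1}[s]starSK; exact: idem_starM.
Qed.

Lemma conjE_mulS s t e : conjE (s ** t) e = conjE t (conjE s e).
Proof. by apply: val_inj => /=; rewrite starSM !mulSA. Qed.

(** Write one factor s as s s^* s and use that s s^* commutes with idempotents. *)
Lemma conjE_mulE s e f : conjE s (mulE e f) = mulE (conjE s e) (conjE s f).
Proof.
apply: val_inj; change (starS s ** (val e ** val f) ** s =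
  starS s ** val e ** s ** (starS s ** val f ** s)).
rewrite -{1}[s]mulSVS starSM starSM starSK -!mulSA; congr (_ ** _).
by rewrite !mulSA range_commute !mulSA.
Qed.

Lemma conjE_idem e f : conjE (val e) f = mulE e f.
Proof.
apply: val_inj; change (starS (val e) ** val f ** val e = val e ** val f).
by rewrite starE -mulSA (idem_mulC (valP f) (valP e)) mulSA idem_mulss ?(valP e).
Qed.

Lemma conjE0 s : conjE s (zeroE X) = zeroE X.
Proof.
by apply: val_inj; change (starS s ** zeroS X ** s = zeroS X); rewrite mulS0 mul0S.
Qed.

Lemma leE_conjE s e f : leE e f -> leE (conjE s e) (conjE s f).
Proof. by move/leEE => h; apply/leEE; rewrite -conjE_mulE h. Qed.

Lemma dom_idem_mul s t : dom_idem (s ** t) = conjE t (dom_idem s).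
Proof. by apply: val_inj => /=; rewrite starSM !mulSA. Qed.

Lemma conjE_range s : conjE s (dom_idem (starS s)) = dom_idem s.
Proof.
apply: val_inj; change (starS s ** (starS (starS s) ** starS s) ** s = starS s ** s).
by rewrite starSK -mulSA mulSVS.
Qed.

Lemma conjE_conjV s e : conjE s (conjE (starS s) e) = mulE e (dom_idem s).
Proof.
rewrite -conjE_mulS.
have -> : starS s ** s = val (dom_idem s) by [].
by rewrite conjE_idem mulEC.
Qed.

Lemma conjV_conjE s e : conjE (starS s) (conjE s e) = mulE e (dom_idem (starS s)).
Proof. by rewrite -conjE_conjV starSK. Qed.

Lemma filter_mulE xi e f : is_filter xi -> xi (mulE e f) <-> xi e /\ xi f.
Proof.
case=> _ up down _; split=> [h|[he hf]].
  by split; [exact: up h (leE_mull e f)|rewrite mulEC in h; exact: up h (leE_mull f e)].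
have [g [hg /leEE ge /leEE gf]] := down _ _ he hf.
by apply: up hg _; apply/leEE; rewrite mulEA ge gf.
Qed.

Definition rset s xi : set (E X) := [set e | xi (conjE s e)].

(** With [rset_idem], this makes [rset] a partial action of S, s being defined on the filters that
    contain s^* s. *)
Lemma rset_mulS s t xi : rset (s ** t) xi = rset s (rset t xi).
Proof. by apply/seteqP; split=> e; rewrite /rset /= conjE_mulS. Qed.

Lemma rset_idem e xi : is_filter xi -> xi e -> rset (val e) xi = xi.
Proof.
move=> fxi xe; apply/seteqP; split=> f; rewrite /rset /= conjE_idem.
  by case/(filter_mulE _ _ fxi).
by move=> xf; apply/(filter_mulE _ _ fxi).
Qed.

Lemma rset_range s xi : xi (dom_idem s) -> rset s xi (dom_idem (starS s)).
Proof. by rewrite /rset /= conjE_range. Qed.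

Lemma rset_filter s xi : is_filter xi -> xi (dom_idem s) -> is_filter (rset s xi).
Proof.
move=> fxi xs; have [_ up down n0] := fxi; split.
- by exists (dom_idem (starS s)); exact: rset_range.
- by move=> e f he ef; apply: up he _; exact: leE_conjE.
- move=> e f he hf; exists (mulE e f); split.
  + by rewrite /rset /= conjE_mulE; apply/filter_mulE.
  + exact: leE_mull.
  + by rewrite mulEC; exact: leE_mull.
- by rewrite /rset /= conjE0.
Qed.

Lemma conjE_dom s e : mulE (conjE s e) (dom_idem s) = conjE s e.
Proof.
apply: val_inj; change (starS s ** val e ** s ** (starS s ** s) = starS s ** val e ** s).
by rewrite -!mulSA [s ** (_ ** _)]mulSA mulSVS.
Qed.

(** Conjugation by s turns a finite cover Z of x into a cover of s^* x s, to which tightness of xi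
    applies: each nonzero y below s^* x s is the conjugate of s y s^*, and the part of s y s^* below
    x is met by Z. *)
Lemma rset_tight s xi : is_tight xi -> xi (dom_idem s) -> is_tight (rset s xi).
Proof.
case=> fxi txi xs; split; first exact: rset_filter.
move=> x Z hx [finZ leZ covZ].
have [|z' [z Zz <-] xz] := txi _ (conjE s @` Z) hx; last by exists z.
split; first exact: finite_image.
  by move=> _ [z /leZ zx <-]; exact: leE_conjE.
move=> y y0 /leEE yx.
have ys : mulE y (dom_idem s) = y by rewrite -yx -mulEA conjE_dom.
have sy : conjE s (conjE (starS s) y) = y by rewrite conjE_conjV.
have [||z Zz yz] := covZ (conjE (starS s) y).
- by move=> h; apply: y0; rewrite -sy h conjE0.
- apply/leEE; rewrite -yx conjE_mulE conjV_conjE.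
  by rewrite -!mulEA [mulE _ x]mulEC !mulEA -[mulE (mulE _ x) x]mulEA mulEE.
exists (conjE s z); first by exists z.
move=> /(@val_inj _ _ _ (mulE y (conjE s z)) (zeroE X)) yz0; apply: yz.
suff : mulE (conjE (starS s) y) z = zeroE X by move/(congr1 val).
(* The product lies below s s^*, so conjugating it by s and back recovers it; it vanishes as soon as
   its conjugate does. *)
have <- : mulE (mulE (conjE (starS s) y) z) (dom_idem (starS s)) =
          mulE (conjE (starS s) y) z.
  by rewrite -mulEA [mulE z _]mulEC mulEA conjE_dom.
by rewrite -conjV_conjE conjE_mulE sy yz0 conjE0.
Qed.
End InverseSemigroup.

(** * Triples in a filter, and the associated word *)

Section Filters.
Context (d : Order.disp_t) (B : cbDistrLatticeType d) (L : eqType).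
Context (X : gbds B L).
Implicit Types (s t : S X) (e : E X) (xi : set (E X)).
Implicit Types (a b c v : seq L) (x y z : B) (w : xword L).

Lemma idem_in_mem xi e a x :
  val (val e) = Some (a, x, a) -> idem_in xi a x <-> xi e.
Proof.
move=> ve; split=> [[f xf vf]|xe]; last by exists e.
by have -> : e = f by do 2!apply: val_inj; rewrite ve vf.
Qed.

Lemma idem_in_S xi a x : idem_in xi a x -> x <> \bot /\ idealw X a x.
Proof. by case=> e _ ve; have := S_in_S (val e); rewrite ve => -[]. Qed.

Lemma E_triple a x : x <> \bot -> idealw X a x ->
  exists e : E X, val (val e) = Some (a, x, a).
Proof.
move=> x0 ax; have h : in_S X (Some (a, x, a)) by [].
pose s : S X := Sub (Some (a, x, a)) (introT (asboolP _) h).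
have hs : idem_raw (val s) by rewrite /= eqxx.
by exists (Sub s hs).
Qed.

Variant E_spec e : Prop :=
  | EZero of e = zeroE X
  | ETriple a x of val (val e) = Some (a, x, a) & x <> \bot & idealw X a x.

Lemma EP e : E_spec e.
Proof.
have := valP e; have := S_in_S (val e); case ve : (val (val e)) => [[[a x] b]|].
  by move=> [x0 ax _] /eqP ab; rewrite -ab in ve; exact: ETriple ve x0 ax.
by move=> _ _; apply: EZero; do 2!apply: val_inj.
Qed.

Lemma mem_triple xi e a x : ~ xi (zeroE X) ->
  val (val e) = triple a x a -> xi e <-> idem_in xi a x.
Proof.
move=> n0; rewrite /triple; case: eqP => [-> ve|_ ve].
  have -> : e = zeroE X by do 2!apply: val_inj.
  by split=> [/n0//|/idem_in_S[]].
exact: iff_sym (idem_in_mem _ ve).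
Qed.

Lemma filter_ext xi eta : ~ xi (zeroE X) -> ~ eta (zeroE X) ->
  (forall a x, idem_in xi a x <-> idem_in eta a x) -> xi = eta.
Proof.
move=> nxi neta h; apply/seteqP; split=> e; case: (EP e) => [->//|a x ve _ _].
  by move/(idem_in_mem _ ve)/h/(idem_in_mem _ ve).
by move/(idem_in_mem _ ve)/h/(idem_in_mem _ ve).
Qed.

Section FilterTheory.
Context (xi : set (E X)) (fxi : is_filter xi).

Lemma filter_zero : ~ xi (zeroE X).
Proof. by case: fxi. Qed.

Lemma idem_in_meet a v x y : idem_in xi a x -> idem_in xi (a ++ v) y ->
  idem_in xi (a ++ v) (thetaw X v x `&` y).
Proof.
case=> e xe ve [f xf vf]; apply/(mem_triple (e := mulE e f) filter_zero).
  by rewrite /= ve vf mul_raw_catl.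
exact/filter_mulE.
Qed.

Lemma idem_in_prefix a v x y : idem_in xi (a ++ v) y -> idealw X a x ->
  y <= thetaw X v x -> idem_in xi a x.
Proof.
move=> hy ax yx; have [y0 _] := idem_in_S hy.
have x0 : x <> \bot.
  by move=> xb; apply: y0; move: yx; rewrite xb thetaw_bot lex0 => /eqP.
have [e ve] := E_triple x0 ax; have [f xf vf] := hy.
apply/(idem_in_mem _ ve); have [_ up _ _] := fxi; apply: (up _ _ xf).
apply: val_inj; rewrite /= ve vf mul_raw_catr.
by rewrite (meet_idPl yx) /triple (introF eqP y0).
Qed.

Lemma idem_in_up a x y : idem_in xi a y -> idealw X a x -> y <= x -> idem_in xi a x.
Proof. by rewrite -{1}[a]cats0; exact: idem_in_prefix. Qed.

(** Incomparable words would make the product of the two idempotents zero, which no filter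
    contains. *)
Lemma idem_in_comparable a b x y : idem_in xi a x -> idem_in xi b y ->
  prefix a b || prefix b a.
Proof.
case=> e xe ve [f xf vf]; apply: contrapT => /negP; rewrite negb_or => /andP[ab ba].
have /(filter_mulE _ _ fxi) : xi e /\ xi f by [].
suff -> : mulE e f = zeroE X by exact: filter_zero.
by do 2!apply: val_inj; rewrite /= ve vf mul_raw_none.
Qed.

(* This fails for [a] empty, since [I_b] may contain elements that are not    *)
(* below any [theta_b A]: the level xi_0 may be empty.                        *)
Lemma idem_in_prefix_ex a v y : a <> [::] -> idem_in xi (a ++ v) y ->
  exists x, idem_in xi a x.
Proof.
case: a => // l a _ hy; have [_ [x lx yx]] := idem_in_S hy.
rewrite thetaw_cat in yx; exists (thetaw X a x).
by apply: idem_in_prefix hy _ yx; exists x.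
Qed.

End FilterTheory.

(** Membership in W follows from the two other conditions: the elements that occur are nonzero, and
    a nonzero element of the ideal of a long beginning lies below theta of an element of the ideal
    of any shorter nonempty one, which is then nonzero too. *)
Lemma assoc_wordI xi w :
  (forall a x, idem_in xi a x -> beginning a w) ->
  match w with
  | Fin s => exists x, idem_in xi s x
  | Inf f => forall n, exists m x, (n <= m)%N /\ idem_in xi (mkseq f m) x
  end -> assoc_word xi w.
Proof.
move=> beg long; split=> //; move: long => {beg}.
case: w => [s [x /idem_in_S[x0 sx]] sW|f h n n1 fW].
  by apply: x0; move: sx; rewrite sW.
have [m [x [nm /idem_in_S[x0]]]] := h n.
have [v ->] := xtake_nat_cat f nm.
have : forall y, idealw X (mkseq f n) y -> y = \bot by move=> y; rewrite fW.
case: {fW} (mkseq f n) (size_mkseq f n) => [n0|l t _ b0 [y ly]].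
  by rewrite -n0 in n1.
rewrite thetaw_cat (b0 (thetaw X t y)); last by exists y.
by rewrite thetaw_bot lex0 => /eqP.
Qed.

Lemma nth_prefix_comparable (l : L) a b i : prefix a b || prefix b a ->
  (i < size a)%N -> (i < size b)%N -> nth l a i = nth l b i.
Proof.
case/orP=> /prefixP[v ->] ia ib; first by rewrite nth_cat ia.
by rewrite nth_cat ib.
Qed.

(** All words occurring in xi are comparable. If their lengths are bounded, a longest one works;
    otherwise they are the beginnings of a single infinite word. *)
Lemma assoc_word_exists xi : is_filter xi -> exists w, assoc_word xi w.
Proof.
move=> fxi; have cmp := idem_in_comparable fxi.
pose P n := `[< exists a x, idem_in xi a x /\ size a = n >].
have [[N bN]|unb] := pselect (exists N, forall n, P n -> (n <= N)%N).
  have exP : exists n, P n.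
    have [[e xe] _ _ n0] := fxi; case: (EP e) => [e0|a x ve _ _].
      by rewrite e0 in xe.
    by exists (size a); apply/asboolP; exists a, x; split=> //; exact/(idem_in_mem _ ve).
  case: (ex_maxnP exP bN) => m /asboolP[s [x [sx sm]]] maxm.
  exists (Fin s); apply: assoc_wordI; last by exists x.
  move=> a y ay; have am : (size a <= size s)%N.
    by rewrite sm; apply: maxm; apply/asboolP; exists a, y.
  exists (size a) => //=; case/orP: (cmp _ _ _ _ ay sx) => /prefixP[v sv].
    by rewrite sv take_size_cat.
  move: am; rewrite sv size_cat -{2}[size s]addn0 leq_add2l leqn0 size_eq0 => /eqP.
  by move->; rewrite cats0 addn0 take_size.
have {unb} unb n : exists a, (exists x, idem_in xi a x) /\ (n < size a)%N.
  apply: contrapT => h; apply: unb; exists n => m /asboolP[a [x [ax <-]]].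
  by rewrite leqNgt; apply/negP => na; apply: h; exists a; split=> //; exists x.
have [a ha] := choice unb.
(* A default letter for [nth]. *)
have [l _] : exists l : L, True.
  by have [_] := ha 0%N; case: (a 0%N) => // l; exists l.
(* The n-th letter is read off a word longer than n; by comparability the choice of that word does
   not matter. *)
pose f n := nth l (a n) n.
have fP b x : idem_in xi b x -> b = mkseq f (size b).
  move=> bx; apply: (@eq_from_nth _ l); rewrite ?size_mkseq // => i ib.
  have [[y ay] ia] := ha i; rewrite nth_mkseq //.
  exact: nth_prefix_comparable (cmp _ _ _ _ bx ay) ib ia.
exists (Inf f); apply: assoc_wordI => [b x bx|n].
  by exists (size b); rewrite //= -(fP _ _ bx).
have [[y ay] ia] := ha n; exists (size (a n)), y.
by rewrite -(fP _ _ ay) ltnW.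
Qed.

End Filters.

(** * Cutting and gluing as instances of the action *)

Section CutGlue.
Context (d : Order.disp_t) (B : cbDistrLatticeType d) (L : eqType).
Context (X : gbds B L).
Implicit Types (s t : S X) (e : E X) (xi : set (E X)).
Implicit Types (a b c v : seq L) (x y z : B) (w : xword L).

Lemma dom_idem_val s a x c : val s = Some (a, x, c) ->
  val (val (dom_idem s)) = Some (c, x, c).
Proof.
move=> vs; have := S_in_S s; rewrite /= vs => -[/eqP x0 _ _] /=.
by rewrite eqxx meetxx /triple (negPf x0).
Qed.

Lemma dom_idemP xi s a x c : val s = Some (a, x, c) ->
  xi (dom_idem s) <-> idem_in xi c x.
Proof. by move=> vs; exact: iff_sym (idem_in_mem _ (dom_idem_val vs)). Qed.

(** Common pattern for the next lemmas, where z is computed from y. As z vanishes with y, a z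
    occurring in xi guarantees that (a, y, a) is a nonzero idempotent. *)
Lemma idem_in_rset xi s a y b z : ~ xi (zeroE X) ->
  (forall e, val (val e) = Some (a, y, a) -> val (val (conjE s e)) = triple b z b) ->
  (y = \bot -> z = \bot) ->
  idem_in (rset s xi) a y <-> idealw X a y /\ idem_in xi b z.
Proof.
move=> n0 h yz; split=> [hy|[ay hz]].
  split; first by case: (idem_in_S hy).
  by case: hy => e he ve; apply/(mem_triple n0 (h _ ve)).
have y0 : y <> \bot by move/yz=> z0; case: (idem_in_S hz).
by have [e ve] := E_triple y0 ay; exists e => //; apply/(mem_triple n0 (h _ ve)).
Qed.

Lemma idem_in_rset_cut xi s c x a y : ~ xi (zeroE X) ->
  val s = Some ([::], x, c) ->
  idem_in (rset s xi) a y <->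
  idealw X a y /\ idem_in xi (c ++ a) (thetaw X a x `&` y).
Proof.
move=> n0 vs; apply: idem_in_rset => // [e ve|->]; last by rewrite meetx0.
rewrite /= vs ve [star_raw _]/= -{2}[a]cat0s mul_raw_catl mul_triplel.
by rewrite -{1}[a]cat0s mul_raw_catr meetAC meetxx.
Qed.

Lemma idem_in_rset_glue xi s b x a y : ~ xi (zeroE X) ->
  val s = Some (b, x, [::]) ->
  idem_in (rset s xi) (b ++ a) y <->
  idealw X (b ++ a) y /\ idem_in xi a (thetaw X a x `&` y).
Proof.
move=> n0 vs; apply: idem_in_rset => // [e ve|->]; last by rewrite meetx0.
rewrite /= vs ve [star_raw _]/= mul_raw_catl mul_triplel.
by rewrite mul_raw_catr meetAC meetxx.
Qed.

(** These are the levels of a glued filter below the length of the glued word, where the gluing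
    formula tests theta_v(y) against the level 0. *)
Lemma idem_in_rset_glue_prefix xi s v x a y : ~ xi (zeroE X) ->
  val s = Some (a ++ v, x, [::]) ->
  idem_in (rset s xi) a y <->
  idealw X a y /\ idem_in xi [::] (x `&` thetaw X v y).
Proof.
move=> n0 vs; apply: idem_in_rset => // [e ve|->]; last first.
  by rewrite thetaw_bot meetx0.
rewrite /= vs ve [star_raw _]/= mul_raw_catr mul_triplel /= eqxx.
by rewrite meetAC meetxx.
Qed.

Lemma idem_in_rset_glue_none xi s b x a y : ~ xi (zeroE X) ->
  val s = Some (b, x, [::]) -> ~~ prefix a b -> ~~ prefix b a ->
  ~ idem_in (rset s xi) a y.
Proof.
move=> n0 vs ab ba.
suff : ~ (idealw X a y /\ idem_in xi a \bot).
  apply: contra_not; rewrite (idem_in_rset (b := a) (z := \bot)) // => e ve.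
  by rewrite triple_bot /= vs ve [star_raw _]/= mul_raw_none.
by case=> _ /idem_in_S[].
Qed.

Lemma idem_in_filter_of w (F : nat -> set B) a y :
  idem_in (filter_of w F : set (E X)) a y <->
  (y <> \bot /\ idealw X a y) /\
  exists n, [/\ le_xsize n w, F n y & a = xtake n w].
Proof.
split=> [h|[[y0 ay] [n [nw Fy aw]]]].
  split; first exact: idem_in_S h.
  by case: h => e [n [z [nw Fz ->]]] [aw <- _]; exists n.
have [e ve] := E_triple y0 ay; exists e => //.
by exists n, y; split=> //; rewrite -aw.
Qed.

Lemma filter_of0 w (F : nat -> set B) : ~ (filter_of w F : set (E X)) (zeroE X).
Proof. by case=> n [x [_ _]]. Qed.

(** Covers the empty word, for which cutting and gluing are the identity by definition. *)
Lemma rset_unit xi s x : is_filter xi -> val s = Some ([::], x, [::]) ->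
  idem_in xi [::] x -> rset s xi = xi.
Proof.
move=> fxi vs hx; have -> : s = val (dom_idem s).
  by apply: val_inj; rewrite (dom_idem_val vs).
by apply: rset_idem => //; apply/(dom_idemP _ vs).
Qed.

(** An element y of I_a lies above some element of xi at the word ca exactly when its meet with
    theta_a(x) is in xi: that meet belongs to I_ca because x is in I_c, and conversely it is itself
    the required element below y. *)
Lemma cutE xi s c x w : is_filter xi -> assoc_word xi (xcat c w) ->
  val s = Some ([::], x, c) -> idem_in xi c x -> cut c w xi = rset s xi.
Proof.
move=> fxi [_ beg _] vs cx; have n0 := filter_zero fxi.
have n0' : ~ rset s xi (zeroE X) by rewrite /rset /= conjE0.
case: c => [|l c] in beg vs cx *; first by rewrite (rset_unit fxi vs cx).
apply: filter_ext => // [|a y]; first exact: filter_of0.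
set lc := l :: c in beg vs cx *.
rewrite idem_in_filter_of (idem_in_rset_cut _ _ n0 vs); split.
  case=> [[y0 ay] [n [nw [_ [z [[_ hz] zy]]] aw]]]; split=> //.
  rewrite xtake_cat -aw in hz.
  have hxz := idem_in_meet fxi cx hz.
  apply: (idem_in_up fxi hxz); last by rewrite leI2.
  apply: idealw_le (idealw_thetaw _ _); first exact: leIl.
  by case: (idem_in_S cx).
case=> ay h; have [xy0 hi] := idem_in_S h.
have [n nw aw] : beginning a w by apply/(beginning_cat lc); exact: beg h.
split; first by split=> // y0; apply: xy0; rewrite y0 meetx0.
exists n; split=> //; split; first by rewrite -aw.
exists (thetaw X a x `&` y); split; last exact: leIr.
by split; rewrite xtake_cat -aw.
Qed.

Lemma assoc_word_cut xi s c x w : is_filter xi -> assoc_word xi (xcat c w) ->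
  val s = Some ([::], x, c) -> idem_in xi c x -> assoc_word (rset s xi) w.
Proof.
move=> fxi [_ beg long] vs cx; have n0 := filter_zero fxi.
have push a y : idem_in xi (c ++ a) y -> idem_in (rset s xi) a y.
  move=> h; apply/(idem_in_rset_cut _ _ n0 vs); split.
    by apply: (@idealw_suffix _ _ _ _ c); case: (idem_in_S h).
  exact: idem_in_meet cx h.
apply: assoc_wordI => [a y|].
  by move=> /(idem_in_rset_cut _ _ n0 vs)[_ /beg]; exact: (beginning_cat _ _ _).1.
case: w long {beg} => [t [y /push ty]|f /= long n]; first by exists y.
have [m [y [nm hy]]] := long (size c + n)%N.
have cm : (size c <= m)%N by rewrite (leq_trans (leq_addr _ _) nm).
exists (m - size c)%N, y; split; first by rewrite leq_subRL.
apply: push; move: hy; rewrite -{1}(subnKC cm).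
by have /= -> := xtake_cat c (Inf f) (m - size c).
Qed.

(** Since x is in xi_0, meeting with x or theta_v(x) does not affect membership in xi, and the
    action of (b, x, 0) reduces to the gluing formula: directly at words bv, through theta at proper
    prefixes of b, while incomparable words occur on neither side. *)
Lemma glueE xi s b x w : is_filter xi -> assoc_word xi w ->
  val s = Some (b, x, [::]) -> idem_in xi [::] x -> glue b w xi = rset s xi.
Proof.
move=> fxi [_ beg _] vs hx; have n0 := filter_zero fxi.
have n0' : ~ rset s xi (zeroE X) by rewrite /rset /= conjE0.
have [_ bx _] : in_S X (Some (b, x, [::])) by rewrite -vs; exact: S_in_S.
case: b => [|l b0] in bx vs *; first by rewrite (rset_unit fxi vs hx).
apply: filter_ext => // [|a y]; first exact: filter_of0.
rewrite /glue; move: (l :: b0) bx vs => {l b0} b bx vs.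
have theta0 v : idem_in xi v (thetaw X v x `&` y) -> y <> \bot.
  by move=> /idem_in_S[xy0 _] y0; apply: xy0; rewrite y0 meetx0.
rewrite idem_in_filter_of.
have [/prefixP[v ->]|ba] := boolP (prefix b a).
  rewrite (idem_in_rset_glue _ _ n0 vs); split.
    case=> _ [n [nw Fy bvn]].
    have nE : n = (size b + size v)%N by rewrite -size_cat bvn size_xtake.
    move: nw Fy bvn; rewrite {n}nE le_xsize_cat xtake_cat => nw.
    rewrite ltnNge leq_addr /= addKn => -[[_ h] bvy] /eqP.
    rewrite eqseq_cat // eqxx => /eqP vw; rewrite -{}vw in h bvy.
    by split=> //; exact: (idem_in_meet (a := [::]) fxi hx h).
  case=> bvy h; have [n nw vw] := beg _ _ h.
  split; first by split=> //; exact: theta0 h.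
  exists (size b + n)%N; rewrite le_xsize_cat xtake_cat -vw; split=> //.
  rewrite ltnNge leq_addr /= addKn /glue_level /level -vw; split=> //; split.
    exact: idealw_suffix bvy.
  apply: (idem_in_up fxi h _ (leIr _ _)); exact: idealw_suffix bvy.
have [/prefixP[v bv]|ab] := boolP (prefix a b); last first.
  split=> [[_ [n [nw _ aw]]]|]; last by move/(idem_in_rset_glue_none n0 vs ab ba).
  have [nb|bn] := leqP n (size b).
    by case/negP: ab; rewrite aw xtake_catl // prefix_take.
  by case/negP: ba; rewrite aw -(subnKC (ltnW bn)) xtake_cat prefix_prefix.
(* The case a = b was covered by the extensions of b, so [a] is a proper prefix. *)
have ab : (size a < size b)%N.
  rewrite bv size_cat -{1}[size a]addn0 ltn_add2l lt0n size_eq0.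
  by apply: contra ba => /eqP v0; rewrite bv v0 cats0 prefix_refl.
have Fa : (if (size a < size b)%N
    then [set z | idealw X (take (size a) b) z /\
                  glue_level b w xi 0 (thetaw X (drop (size a) b) z)]
    else glue_level b w xi (size a - size b)) y <->
  idealw X a y /\ idem_in xi [::] (thetaw X v y).
  rewrite ab bv take_size_cat // drop_size_cat //=.
  rewrite /glue_level /level (_ : xtake 0 w = [::]) ?cats0; last first.
    by case: w {beg} => [[]|].
  split=> [[ay [[_ h] _]]//|[ay h]]; split=> //; split=> //.
  exact: idealw_thetaw.
rewrite (@idem_in_rset_glue_prefix _ _ v x) -?bv //; split.
  case=> _ [n [nw Fy aw]]; have nE : n = size a by rewrite aw size_xtake.
  move: Fy; rewrite nE => /Fa[ay h]; split=> //.
  exact: (idem_in_meet (v := [::]) fxi hx h).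
case=> ay h; split.
  by split=> // y0; case: (idem_in_S h); rewrite y0 thetaw_bot meetx0.
exists (size a); split; first by rewrite le_xsize_catl // ltnW.
  apply/Fa; split=> //; exact: (idem_in_up fxi h _ (leIr _ _)).
by rewrite xtake_catl ?(ltnW ab) // bv take_size_cat.
Qed.

Lemma assoc_word_glue xi s b x w : is_filter xi -> assoc_word xi w ->
  val s = Some (b, x, [::]) -> idem_in xi [::] x ->
  assoc_word (rset s xi) (xcat b w).
Proof.
move=> fxi [_ beg long] vs hx; have n0 := filter_zero fxi.
have [_ bx _] : in_S X (Some (b, x, [::])) by rewrite -vs; exact: S_in_S.
have push a y : idem_in xi a y -> idem_in (rset s xi) (b ++ a) (thetaw X a x `&` y).
  move=> h; apply/(idem_in_rset_glue _ _ n0 vs); split.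
    by apply: idealw_le (idealw_thetaw _ bx); exact: leIl.
  by rewrite meetA meetxx; exact: (idem_in_meet (a := [::]) fxi hx h).
apply: assoc_wordI => [a y|].
  have [/prefixP[v ->]|ba] := boolP (prefix b a).
    case/(idem_in_rset_glue _ _ n0 vs) => _ /beg; exact: (beginning_cat _ _ _).2.
  have [/prefixP[v bv] _|ab] := boolP (prefix a b); last first.
    by move/(idem_in_rset_glue_none n0 vs ab ba).
  rewrite -(take_size_cat v (erefl (size a))) -bv; apply: beginning_take.
  by rewrite bv size_cat leq_addr.
case: w long {beg} => [t [y /push ty]|f /= long n]; first by eexists; exact: ty.
have [m [y [nm hy]]] := long n.
exists (size b + m)%N, (thetaw X (mkseq f m) x `&` y).
split; first exact: leq_trans nm (leq_addl _ _).
by have /= -> := xtake_cat b (Inf f) m; exact: push.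
Qed.

End CutGlue.

(** The equivalences reflect products and inverses, so every axiom for G is the corresponding axiom
    for H; no separate proof for G is required. *)
Lemma groupoid_iso_transfer (G H : groupoid_data) (f : G -> H) (g : H -> G) :
  is_groupoid H -> cancel f g -> cancel g f ->
  (forall x y z, gmul x y z <-> gmul (f x) (f y) (f z)) ->
  (forall x y, ginv x y <-> ginv (f x) (f y)) ->
  groupoid_iso f.
Proof.
move=> Hgr fK gK mulE invE; have f_inj := can_inj fK.
have compE x y : composable x y <-> composable (f x) (f y).
  split=> -[z xyz]; first by exists (f z); exact/mulE.
  by exists (g z); apply/mulE; rewrite gK.
split=> //; last 2 first.
- by move=> x y z /mulE.
- by exists g; split=> // x y z xyz; apply/mulE; rewrite !gK.
split.
- by move=> x y z z' /mulE h /mulE h'; apply: f_inj; exact (gmul_fun Hgr h h').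
- by move=> x y y' /invE h /invE h'; apply: f_inj; exact (ginv_fun Hgr h h').
- by move=> x; have [y xy] := ginv_total Hgr (f x); exists (g y); apply/invE; rewrite gK.
- by move=> x y /invE/(ginv_invol Hgr)/invE.
- move=> x y z /compE xy /compE yz.
  have [xy' [yz' [w [h1 h2 h3 h4]]]] := gmul_assoc Hgr xy yz.
  by exists (g xy'), (g yz'), (g w); split; apply/mulE; rewrite !gK.
- move=> x x' /invE/(gmul_invl Hgr)[/compE c h]; split=> // y xy /mulE/h.
  by move/mulE.
- move=> x x' /invE/(gmul_invr Hgr)[/compE c h]; split=> // y xy /mulE/h.
  by move/mulE.
Qed.

(** * The degree, and the triple attached to a germ *)

Section Phi.
Context (d : Order.disp_t) (B : cbDistrLatticeType d) (L : eqType).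
Context (X : gbds B L).
Implicit Types (s t : S X) (e : E X) (xi eta : set (E X)) (u v : Omega X).
Implicit Types (a b c : seq L) (x y z : B) (w : xword L).

(** The value at zero is a default; additivity is only claimed for nonzero products. *)
Definition degree s : int :=
  if val s is Some (b, _, c) then sizediff b c else 0%R.

Lemma degree_mulS s t : s ** t <> zeroS X ->
  degree (s ** t) = (degree s + degree t)%R.
Proof.
move=> st0; have {st0} : val (s ** t) <> None.
  by move=> h; apply: st0; exact: val_inj.
rewrite /degree /=; case: (sval s) => [[[a x] b]|//].
case: (sval t) => [[[c y] e]|//].
have [v ->|v ->|bc cb] := compare_wordsP b c; last by rewrite mul_raw_none.
- rewrite mul_raw_catl /triple; case: eqP => // _ _.
  by rewrite /sizediff !size_cat !PoszD; ring.
- rewrite mul_raw_catr /triple; case: eqP => // _ _.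
  by rewrite /sizediff !size_cat !PoszD; ring.
Qed.

Lemma degree_idem e : degree (val e) = 0%R.
Proof.
by case: (EP e) => [-> //|a x ve _ _]; rewrite /degree ve /sizediff subrr.
Qed.

Lemma degree_starS s : degree (starS s) = (- degree s)%R.
Proof.
rewrite /degree /=; case: (sval s) => [[[a x] b]|] /=; last by rewrite oppr0.
by rewrite /sizediff opprB.
Qed.

Lemma dom_idem_neq0 xi s : is_filter xi -> xi (dom_idem s) -> s <> zeroS X.
Proof.
move=> fxi xs s0; apply: (filter_zero fxi); move: xs; rewrite s0.
suff -> : dom_idem (zeroS X) = zeroE X by [].
by do 2!apply: val_inj.
Qed.

Lemma triple_of_dom xi s : is_filter xi -> xi (dom_idem s) ->
  exists b x c, [/\ val s = Some (b, x, c), idealw X b x, idealw X c x,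
                    x <> \bot & idem_in xi c x].
Proof.
move=> fxi xs; have := S_in_S s; case vs : (val s) => [[[b x] c]|].
  by move=> [x0 bx cx]; exists b, x, c; split=> //; exact/(dom_idemP _ vs).
by case: (dom_idem_neq0 fxi xs); exact: val_inj.
Qed.

Lemma S_triple b x c : x <> \bot -> idealw X b x -> idealw X c x ->
  exists s, val s = Some (b, x, c).
Proof.
move=> x0 bx cx; have h : in_S X (Some (b, x, c)) by [].
by exists (Sub (Some (b, x, c)) (introT (asboolP _) h)).
Qed.

(** The action of s thus becomes cutting c followed by gluing b. Both factors lie in S because the
    ideal of the empty word is everything. *)
Lemma S_factor s b x c : val s = Some (b, x, c) ->
  exists p q, [/\ s = p ** q, val p = Some (b, x, [::]) & val q = Some ([::], x, c)].
Proof.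
move=> vs; have := S_in_S s; rewrite vs => -[x0 bx cx].
have [p vp] := @S_triple b x [::] x0 bx I.
have [q vq] := @S_triple [::] x c x0 I cx.
exists p, q; split=> //; apply: val_inj; rewrite /= vp vq vs /= meetxx /triple.
by case: eqP.
Qed.

Lemma rset_starS s xi : is_filter xi -> xi (dom_idem s) ->
  rset (starS s) (rset s xi) = xi.
Proof. by move=> fxi xs; rewrite -rset_mulS (rset_idem (e := dom_idem s)). Qed.

(** With s = p q as in [S_factor], cutting b is the action of p^*, which undoes the gluing by p;
    this gives the last equation, the one required by membership in Gamma. *)
Lemma cut_glue_rset xi s b c x w : is_tight xi -> val s = Some (b, x, c) ->
  idem_in xi c x -> assoc_word xi (xcat c w) ->
  [/\ is_tight (cut c w xi), assoc_word (cut c w xi) w & idem_in (cut c w xi) [::] x] /\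
  [/\ glue b w (cut c w xi) = rset s xi, assoc_word (rset s xi) (xcat b w) &
      cut b w (rset s xi) = cut c w xi].
Proof.
move=> txi vs cx wxi.
have fxi := txi.1; have [p [q [spq vp vq]]] := S_factor vs.
have qxi : xi (dom_idem q) by exact/(dom_idemP _ vq).
rewrite (cutE fxi wxi vq cx); set eta := rset q xi.
have teta : is_tight eta by exact: rset_tight.
have feta := teta.1.
have weta : assoc_word eta w := assoc_word_cut fxi wxi vq cx.
have vq' : val (starS q) = Some (c, x, [::]) by rewrite /= vq.
have hx : idem_in eta [::] x by apply/(dom_idemP _ vq'); exact: rset_range.
have peta : eta (dom_idem p) by exact/(dom_idemP _ vp).
have vp' : val (starS p) = Some ([::], x, b) by rewrite /= vp.
have bx : idem_in (rset p eta) b x by apply/(dom_idemP _ vp'); exact: rset_range.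
rewrite spq rset_mulS -/eta (glueE feta weta vp hx); split=> //; split=> //.
  exact: assoc_word_glue feta weta vp hx.
by rewrite (cutE _ _ vp') ?rset_starS //;
  [exact: rset_filter|exact: assoc_word_glue feta weta vp hx].
Qed.

Lemma filter_of_char_inj (phi psi : E X -> bool) :
  filter_of_char phi = filter_of_char psi -> phi = psi.
Proof.
move=> h; apply/funext => e.
have he : is_true (phi e) = is_true (psi e) := congr1 (fun A : set (E X) => A e) h.
by apply/idP/idP; rewrite he.
Qed.

Lemma filter_of_char_rho s (phi : E X -> bool) :
  filter_of_char (rho s phi) = rset s (filter_of_char phi).
Proof. by []. Qed.

(** The value of Phi, in a form that mentions no associated word. *)
Definition germ_triple u : set (E X) * int * set (E X) :=
  (rset (val u).1 (filter_of_char (val u).2), degree (val u).1,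
   filter_of_char (val u).2).

Lemma OmegaP u : is_tight (filter_of_char (val u).2) /\
  filter_of_char (val u).2 (dom_idem (val u).1).
Proof. exact: asboolW (valP u). Qed.

Lemma Omega_intro s (phi : E X -> bool) : is_tight (filter_of_char phi) ->
  filter_of_char phi (dom_idem s) -> exists u, val u = (s, phi).
Proof.
move=> tphi sphi.
have h : tight_char (s, phi).2 /\ (s, phi).2 (dom_idem (s, phi).1) by [].
by exists (Sub (s, phi) (introT (asboolP _) h)).
Qed.

Lemma dom_idemE e : dom_idem (val e) = e.
Proof.
by apply: val_inj; change (starS (val e) ** val e = val e);
   rewrite starE idem_mulss ?(valP e).
Qed.

Lemma rset_mul_idem s e xi : is_filter xi -> xi e -> rset (s ** val e) xi = rset s xi.
Proof. by move=> fxi xe; rewrite rset_mulS rset_idem. Qed.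

Lemma degree_mul_idem s e xi : is_filter xi -> xi (dom_idem s) -> xi e ->
  degree (s ** val e) = degree s.
Proof.
move=> fxi xs xe; rewrite degree_mulS ?degree_idem ?addr0 //.
apply: (dom_idem_neq0 fxi); rewrite dom_idem_mul conjE_idem.
exact/(filter_mulE _ _ fxi).
Qed.

Lemma germ_separation s t xi : is_filter xi -> xi (dom_idem s) -> xi (dom_idem t) ->
  degree s = degree t -> rset s xi = rset t xi ->
  exists2 e, xi e & s ** val e = t ** val e.
Proof.
move=> fxi xs xt.
have [b [x [c [vs bx cx x0 hx]]]] := triple_of_dom fxi xs.
have [b' [x' [c' [vt bx' cx' x0' hx']]]] := triple_of_dom fxi xt.
(* Both c and c' occur in xi, and the claim is symmetric in s and t. *)
wlog /prefixP[v c'v] : s t b b' c c' x x' xs xt vs vt bx cx x0 hx bx' cx' x0' hx' /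
    prefix c c'.
  move=> wl; case/orP: (idem_in_comparable fxi hx hx');
    first by move=> cc'; apply: (wl s t b b' c c' x x').
  move=> cc' dst rst; have [||e xe ste] := wl t s b' b c' c x' x
    xt xs vt vs bx' cx' x0' hx' bx cx x0 hx cc' => //.
  by exists e.
rewrite {1 2}/degree vs vt /sizediff c'v size_cat => dst rst.
have frs : is_filter (rset s xi) by exact: rset_filter.
have sz : size b' = (size b + size v)%N by lia.
have vs' : val (starS s) = Some (c, x, b) by rewrite /= vs.
have vt' : val (starS t) = Some (c', x', b') by rewrite /= vt.
have hb : idem_in (rset s xi) b x by apply/(dom_idemP _ vs'); exact: rset_range.
have hb' : idem_in (rset s xi) b' x'.
  by rewrite rst; apply/(dom_idemP _ vt'); exact: rset_range.
have size_le_prefix (r r' : seq L) : (size r <= size r')%N ->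
    prefix r r' || prefix r' r -> prefix r r'.
  move=> rr' /orP[//|/prefixP[q rq]]; move: rr'.
  rewrite rq size_cat -{2}[size r']addn0 leq_add2l leqn0 size_eq0 => /eqP->.
  by rewrite cats0 prefix_refl.
have /prefixP[u bu] : prefix b b'.
  by apply: size_le_prefix (idem_in_comparable frs hb hb'); rewrite sz leq_addr.
(* Acting backwards by s, the word bu in the common image yields cu in xi; it is comparable with cv
   and has the same length. *)
have uv : u = v.
  have suv : size u = size v by apply/eqP; rewrite -(eqn_add2l (size b)) -sz bu size_cat.
  have [p [q [spq vp vq]]] := S_factor vs; move: hb'; rewrite bu spq rset_mulS.
  have n0 := filter_zero fxi; have n0q : ~ rset q xi (zeroE X) by rewrite /rset /= conjE0.
  case/(idem_in_rset_glue _ _ n0q vp) => _ /(idem_in_rset_cut _ _ n0 vq)[_ hu].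
  have := idem_in_comparable fxi hu hx'; rewrite c'v !prefix_cat2l.
  move/size_le_prefix; rewrite suv leqnn => /(_ isT)/prefixP[r vr].
  move: suv; rewrite vr size_cat -{1}[size u]addn0 => /addnI/esym/size0nil ->.
  by rewrite cats0.
rewrite uv in bu; rewrite {}c'v in vt cx' hx'; rewrite {}bu in vt bx' hb'.
(* The meet of theta_v(x) and x', at the word cv, is the idempotent on which s and t agree. *)
have hy := idem_in_meet fxi hx hx'.
have [y0 cy] := idem_in_S hy; have [e ve] := E_triple y0 cy.
exists e; first exact/(idem_in_mem _ ve).
apply: val_inj; rewrite /= vs vt ve mul_raw_catl.
rewrite -{1 3}[c ++ v]cats0 mul_raw_catl !cats0 /= meetA meetxx.
by rewrite meetCA meetxx.
Qed.

(** From left to right this is well-definedness of Phi, from right to left its injectivity. *)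
Lemma germ_eqP u v : germ_eq u v <-> germ_triple u = germ_triple v.
Proof.
have [[fu _] su] := OmegaP u; have [[fv _] sv] := OmegaP v.
rewrite /germ_triple; split=> [[euv [e [ue ste]]]|[rst dst /filter_of_char_inj euv]].
  rewrite -euv in sv *; congr (_, _, _).
    by rewrite -(rset_mul_idem _ fu ue) ste (rset_mul_idem _ fu ue).
  by rewrite -(degree_mul_idem fu su ue) ste (degree_mul_idem fu sv ue).
rewrite -euv in sv rst.
by have [e ue ste] := germ_separation fu su sv dst rst; split=> //; exists e.
Qed.

Lemma germ_eqE u v : germ u = germ v <-> germ_triple u = germ_triple v.
Proof.
rewrite -germ_eqP; split=> [/(congr1 val)/= h|/germ_eqP uv].
  have : [set w' | germ_eq v w'] v by apply/germ_eqP.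
  by rewrite -h.
by apply: val_inj; apply/seteqP; split=> w /germ_eqP h; apply/germ_eqP; rewrite -h uv.
Qed.

Lemma germ_surj (C : Gtight_arrow X) : exists u, C = germ u.
Proof. by have [u Cu] := asboolW (valP C); exists u; apply: val_inj. Qed.

Lemma triple_of_Omega u : exists b x c,
  [/\ val (val u).1 = Some (b, x, c), idealw X b x &
      idem_in (filter_of_char (val u).2) c x].
Proof.
have [[fu _] su] := OmegaP u.
by have [b [x [c [vs bx _ _ cx]]]] := triple_of_dom fu su; exists b, x, c.
Qed.

Lemma assoc_word_split xi c x : is_filter xi -> idem_in xi c x ->
  exists w, assoc_word xi (xcat c w).
Proof.
move=> fxi cx; have [w0 w0xi] := assoc_word_exists fxi.
have [_ beg _] := w0xi.
by have [w w0E] := beginning_split (beg _ _ cx); exists w; rewrite -w0E.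
Qed.

(** * The triples of germs are exactly the elements of Gamma *)

Lemma germ_triple_in_Gamma u : in_Gamma (germ_triple u).
Proof.
have [tu su] := OmegaP u; have [b [x [c [vs bx cx]]]] := triple_of_Omega u.
have [w wxi] := assoc_word_split tu.1 cx; exists b, c, w.
have [_ [_ wr crs]] := cut_glue_rset tu vs cx wxi.
split=> //=; first by split=> //; exact: rset_tight.
by rewrite /degree vs.
Qed.

Lemma T_word_level xi a w : a <> [::] -> T_ (xcat a w) xi ->
  exists x, idem_in xi a x.
Proof.
move=> a0 [[fxi _] [_ _ long]]; case: w long => [t [x]|f /= long].
  exact: idem_in_prefix_ex.
have [m [x [am]]] := long (size a).
rewrite -(subnKC am); have /= -> := xtake_cat a (Inf f) (m - size a).
exact: idem_in_prefix_ex.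
Qed.

(** If [a] is empty, then b is not, and eta is the cut of xi by b, that is q.xi with q = (0, x, b);
    it contains q q^* = (0, x, 0). When both words are empty the level 0 may be empty, hence the
    last hypothesis. *)
Lemma word_level a b w eta xi : T_ (xcat a w) eta -> T_ (xcat b w) xi ->
  cut a w eta = cut b w xi -> ~~ (nilp a && nilp b) -> exists y, idem_in eta a y.
Proof.
have [->|a0] := eqVneq a [::]; last by move=> Teta *; apply: T_word_level Teta; exact/eqP.
move=> _ Txi /= -> b0; have [x bx] : exists x, idem_in xi b x.
  by apply: T_word_level Txi => b0'; rewrite b0' in b0.
case: Txi => [[fxi txi] wxi]; have [x0 ix] := idem_in_S bx.
have [q vq] := @S_triple [::] x b x0 I ix.
rewrite (cutE fxi wxi vq bx); exists x.
apply/(@dom_idemP _ _ _ _ _ (starS q) b); first by rewrite /= vq.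
by apply: rset_range; apply/(dom_idemP _ vq).
Qed.

Lemma germ_triple_surj g : in_Gamma g -> exists u, germ_triple u = g.
Proof.
case: g => [[eta m] xi] [a [b [w [/= Teta Txi -> etaxi]]]].
(* It suffices to find s in S acting on xi with image eta and the right degree; xi becomes a
   character by boolean reflection. *)
have lift s : xi (dom_idem s) -> rset s xi = eta -> degree s = sizediff a b ->
    exists u, germ_triple u = (eta, sizediff a b, xi).
  have xiE : filter_of_char (fun e => `[< xi e >]) = xi.
    by apply/seteqP; split=> e /asboolP.
  move=> xs <- <-; have [||u vu] := @Omega_intro s (fun e => `[< xi e >]);
    rewrite ?xiE //; first by case: Txi.
  by exists u; rewrite /germ_triple vu /= xiE.
have [[teta weta] [txi wxi]] := (Teta, Txi).
have feta := teta.1; have fxi := txi.1.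
have [/andP[/nilP a0 /nilP b0]|ab0] := boolP (nilp a && nilp b).
  subst a b; have [[e xe] _ _ _] := fxi.
  apply: (lift (val e)); last by rewrite degree_idem.
    by rewrite dom_idemE.
  by rewrite rset_idem //; exact: esym etaxi.
have [y ay] := word_level Teta Txi etaxi ab0.
have [z bz] : exists z, idem_in xi b z.
  by apply: word_level Txi Teta (esym etaxi) _; rewrite andbC.
have [y0 iy] := idem_in_S ay; have [z0 iz] := idem_in_S bz.
have [p vp] := @S_triple [::] y a y0 I iy.
have [q vq] := @S_triple [::] z b z0 I iz.
have pq : rset p eta = rset q xi.
  by rewrite -(cutE feta weta vp ay) -(cutE fxi wxi vq bz).
have peta : eta (dom_idem p) by apply/(dom_idemP _ vp).
have dpq : xi (dom_idem (starS p ** q)).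
  by rewrite dom_idem_mul; suff : rset q xi (dom_idem (starS p)) by []; 
     rewrite -pq; exact: rset_range.
apply: (lift (starS p ** q)) => //; first by rewrite rset_mulS -pq rset_starS.
rewrite degree_mulS; last exact: dom_idem_neq0 dpq.
by rewrite degree_starS /degree vp vq /sizediff /=; lia.
Qed.

(** * Groupoid structures on germs and on Gamma *)

Definition Gamma_of u : Gamma_arrow X :=
  Sub (germ_triple u) (introT (asboolP _) (germ_triple_in_Gamma u)).

Lemma val_Gamma_of u : val (Gamma_of u) = germ_triple u.
Proof. by []. Qed.

Lemma Gamma_of_surj (g : Gamma_arrow X) : exists u, Gamma_of u = g.
Proof.
have [u ug] := germ_triple_surj (asboolW (valP g)).
by exists u; apply: val_inj.
Qed.

Lemma Gamma_of_eq u v : Gamma_of u = Gamma_of v <-> germ u = germ v.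
Proof. by rewrite germ_eqE; split=> [/(congr1 val)//|h]; apply: val_inj. Qed.

(** The product of germs is given by some choice of representatives. Conversely, matching filters in
    Gamma force the character of u to be the image of that of v, so u and v themselves can be
    multiplied. *)
Lemma Gtight_mulE (u v w : Omega X) :
  Gtight_mul (germ u) (germ v) (germ w) <->
  Gamma_mul (Gamma_of u) (Gamma_of v) (Gamma_of w).
Proof.
have mul_triple (u1 v1 w1 : Omega X) : (val u1).2 = rho (val v1).1 (val v1).2 ->
    val w1 = ((val u1).1 ** (val v1).1, (val v1).2) ->
    germ_triple w1 =
    ((germ_triple u1).1.1, ((germ_triple u1).1.2 + (germ_triple v1).1.2)%R,
     (germ_triple v1).2).
  move=> uv1 vw1; have [[fw _] sw] := OmegaP w1.
  have nz := dom_idem_neq0 fw sw; rewrite vw1 in nz.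
  by rewrite /germ_triple vw1 uv1 /= rset_mulS degree_mulS.
split.
  case=> u1 [v1 [w1 [/germ_eqE uu1 /germ_eqE vv1 /germ_eqE ww1 uv1 vw1]]].
  rewrite /Gamma_mul !val_Gamma_of uu1 vv1 ww1 (mul_triple _ _ _ uv1 vw1); split=> //=.
  by rewrite uv1.
rewrite /Gamma_mul !val_Gamma_of => -[uv wE].
have {uv} uv : (val u).2 = rho (val v).1 (val v).2.
  exact: filter_of_char_inj.
have [tv sv] := OmegaP v; have [tu su] := OmegaP u.
have [||w1 vw1] := @Omega_intro ((val u).1 ** (val v).1) (val v).2 => //.
  by rewrite dom_idem_mul; move: su; rewrite uv.
exists u, v, w1; split=> //; apply/germ_eqE.
by rewrite wE (mul_triple _ _ _ uv vw1).
Qed.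

Lemma Gtight_invE u v : Gtight_inv (germ u) (germ v) <->
  Gamma_inv (Gamma_of u) (Gamma_of v).
Proof.
have inv_triple (u1 v1 : Omega X) :
    val v1 = (starS (val u1).1, rho (val u1).1 (val u1).2) ->
    germ_triple v1 =
    ((germ_triple u1).2, (- (germ_triple u1).1.2)%R, (germ_triple u1).1.1).
  move=> vv1; have [[fu _] su] := OmegaP u1.
  by rewrite /germ_triple vv1 /= degree_starS filter_of_char_rho rset_starS.
split=> [[u1 [v1 [/germ_eqE uu1 /germ_eqE vv1 v1E]]]|h].
  by rewrite /Gamma_inv !val_Gamma_of uu1 vv1 (inv_triple _ _ v1E).
have [tu su] := OmegaP u.
have [||v1 v1E] := @Omega_intro (starS (val u).1) (rho (val u).1 (val u).2).
- by rewrite filter_of_char_rho; exact: rset_tight.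
- by rewrite filter_of_char_rho; exact: rset_range.
exists u, v1; split=> //; apply/germ_eqE; rewrite (inv_triple _ _ v1E); exact: h.
Qed.

(** Closure of Gamma under products is not immediate, since the two cut identities may involve
    unrelated words; the product in S of two lifts provides the composite. *)
Lemma Gamma_composable (g h : Gamma X) :
  (val g).2 = (val h).1.1 -> composable g h.
Proof.
have [u <-] := Gamma_of_surj g; have [v <-] := Gamma_of_surj h => /= uv.
have {}uv : (val u).2 = rho (val v).1 (val v).2 by exact: filter_of_char_inj.
have [tv sv] := OmegaP v; have [tu su] := OmegaP u.
have [||w vw] := @Omega_intro ((val u).1 ** (val v).1) (val v).2 => //.
  by rewrite dom_idem_mul; move: su; rewrite uv.
by exists (Gamma_of w); apply/Gtight_mulE; exists u, v, w.
Qed.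

Lemma Gamma_groupoid : is_groupoid (Gamma X).
Proof.
split.
- by move=> x y z z' [_ h] [_ h']; apply: val_inj; rewrite h h'.
- by move=> x y y' h h'; apply: val_inj; rewrite h h'.
- move=> x; have [a [b [w [Ta Tb m ab]]]] := asboolW (valP x).
  have h : in_Gamma ((val x).2, (- (val x).1.2)%R, (val x).1.1).
    by exists b, a, w; split=> //=; rewrite m /sizediff opprB.
  by exists (Sub ((val x).2, (- (val x).1.2)%R, (val x).1.1) (introT (asboolP _) h)).
- by move=> x y h; rewrite /= /Gamma_inv h /= opprK; case: (val x) => [[]].
- move=> x y z [_ [xy _]] [_ [yz _]].
  have [p [_ pE]] := Gamma_composable xy; have [q [_ qE]] := Gamma_composable yz.
  have [|w [_ wE]] := @Gamma_composable p z; first by rewrite pE.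
  exists p, q, w; split=> //; split=> //.
  + by rewrite pE.
  + by rewrite qE.
  + by rewrite wE pE qE /= addrA.
- move=> x x' h; split; first by apply: Gamma_composable; rewrite h.
  move=> y xy [xyc xyE]; split; first by rewrite h xyE.
  rewrite h xyE /= addrA addNr add0r; move: xyc => /= ->.
  by case: (sval y) => [[]].
- move=> x x' h; split; first by apply: Gamma_composable; rewrite h.
  move=> z zx [zxc zxE]; split; first by rewrite h zxE.
  rewrite h zxE /= -addrA addrN addr0; move: zxc => /= <-.
  by case: (sval z) => [[]].
Qed.

End Phi.

Theorem theorem5p6 (d : Order.disp_t) (B : cbDistrLatticeType d) (L : eqType)
    (X : gbds B L) :
  exists F : Gtight X -> Gamma X, is_Phi F /\ groupoid_iso F.
Proof.
have [rep repE] := choice (@germ_surj d B L X).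
have [sec secE] := choice (@Gamma_of_surj d B L X).
(* Phi is computed on a chosen representative; [F_germ] shows that the choice is irrelevant. *)
pose F (C : Gtight X) : Gamma X := Gamma_of (rep C).
have F_germ u : F (germ u) = Gamma_of u by apply/Gamma_of_eq; rewrite -repE.
exists F; split.
  move=> u b c x vs xi; have [txi su] := OmegaP u.
  have cx : idem_in xi c x by apply/(dom_idemP _ vs).
  split=> [|w wxi].
    have [w wxi] := assoc_word_split txi.1 cx; exists w.
    have [[tc wc hx] [_ wr _]] := cut_glue_rset txi vs cx wxi.
    split=> //; first by case: wc.
    split=> // _; split; first by case: wr.
    (* The middle entry x of the representative is itself in the level 0 of the cut filter and in
       I_b. *)
    exists x; split; last by have := S_in_S (val u).1; rewrite vs => -[].
    by split=> //; case: w {wc wr wxi tc} hx => [[]|].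
  have [_ [glueE _ _]] := cut_glue_rset txi vs cx wxi.
  by rewrite F_germ glueE /= /germ_triple /degree vs.
apply: (@groupoid_iso_transfer (Gtight X) (Gamma X) F (fun g => germ (sec g))).
- exact: Gamma_groupoid.
- by move=> C; rewrite [RHS]repE; apply/Gamma_of_eq; rewrite secE.
- by move=> g; rewrite F_germ secE.
- by move=> C D K; rewrite {1}(repE C) {1}(repE D) {1}(repE K); exact: Gtight_mulE.
- by move=> C D; rewrite {1}(repE C) {1}(repE D); exact: Gtight_invE.
Qed.
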